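(* Suppose $\mathcal A_1$ and $\mathcal A_2$ are two self-adjoint extensions of $A$ with $\mathrm{dom}(\mathcal A_j)\subset\mathcal D$, $j=1,2$, and put $R_j(\zeta):=(\mathcal A_j-\zeta)^{-1}$. Then for every $\zeta\in\mathbb C\setminus(\mathrm{Spec}(\mathcal A_1)\cup\mathrm{Spec}(\mathcal A_2))$ one has $$R_2(\zeta)-R_1(\zeta)=(\Gamma_0R_2(\overline\zeta))^*\,\Gamma_1R_1(\zeta)-(\Gamma_1R_2(\overline\zeta))^*\,\Gamma_0R_1(\zeta),$$ $$R_2(\zeta)-R_1(\zeta)=(\mathrm T R_2(\overline\zeta))^*\,J\,\mathrm T R_1(\zeta),$$ where $\mathrm T R_j(\overline\zeta)=(\Gamma_0R_j(\overline\zeta),\Gamma_1R_j(\overline\zeta))$ is considered as an operator in $\mathcal B(\mathcal H,\mathfrak H\times\mathfrak H)$. Assume, further, that for $j=1,2$ the subspace $\overline{\mathrm T(\mathrm{dom}\,\mathcal A_j)}$ is a Lagrangian plane in $\mathfrak H\times\mathfrak H$ and $\overline{\mathrm T(\mathrm{dom}\,\mathcal A_j)}=\ker([X_j,Y_j])$, where $X_j,Y_j\in\mathcal B(\mathfrak H)$ satisfy $X_jY_j^*=Y_jX_j^*$ and $0\notin\mathrm{Spec}\begin{bmatrix}X_j&Y_j\\-Y_j&X_j\end{bmatrix}$, and let $Q_j$ denote the orthogonal projection in $\mathfrak H\times\mathfrak H$ onto $\overline{\mathrm T(\mathrm{dom}\,\mathcal A_j)}$. Then $$R_2(\zeta)-R_1(\zeta)=(\mathrm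 T R_2(\overline\zeta))^*\,Q_2JQ_1\,\mathrm T R_1(\zeta),\qquad R_2(\zeta)-R_1(\zeta)=(\mathrm T R_2(\overline\zeta))^*\,Z_{2,1}\,\mathrm T R_1(\zeta),$$ where $Z_{2,1}=(W(X_2,Y_2))^*(X_2Y_1^*-Y_2X_1^* )\,W(X_1,Y_1)$.
   Context: Inner products are linear in the first argument. $\mathcal H,\mathfrak H$ are complex separable Hilbert spaces; $A$ is a densely defined, closed, symmetric operator in $\mathcal H$ with equal (possibly infinite) deficiency indices; $\mathcal H_+:=\mathrm{dom}(A^* )$ carries the graph inner product $\langle u,v\rangle_{\mathcal H_+}=\langle u,v\rangle_{\mathcal H}+\langle A^*u,A^*v\rangle_{\mathcal H}$. $\mathcal D$ is a dense subspace of $\mathcal H_+$ with $\mathrm{dom}(A)\subset\mathcal D$. The trace operator $\mathrm T=[\Gamma_0,\Gamma_1]^\top:\mathcal H_+\supset\mathcal D\to\mathfrak H\times\mathfrak H$ is a linear operator with domain $\mathcal D$ and dense range, satisfying the abstract Green identity $$\langle A^*u,v\rangle_{\mathcal H}-\langle u,A^*v\rangle_{\mathcal H}=\langle\Gamma_1u,\Gamma_0v\rangle_{\mathfrak H}-\langle\Gamma_0u,\Gamma_1v\rangle_{\mathfrak H},\quad u,v\in\mathcal D.$$ $J=\begin{bmatrix}0&I_{\mathfrak H}\\-I_{\mathfrak H}&0\end{bmatrix}$, $\omega(f,g)=\langle Jf,g\rangle_{\mathfrak H\times\mathfrak H}$. A subspace $\mathcal F\subset\mathfrak H\times\mathfrak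 H$ is Lagrangian if $\mathcal F=\mathcal F^\circ:=\{f:\omega(f,g)=0\ \forall g\in\mathcal F\}$. $[X,Y](f_1,f_2)^\top=Xf_1+Yf_2$. For $X,Y$ as in the claim, $W(X,Y):=(XX^*+YY^* )^{-1}[-Y,X]\in\mathcal B(\mathfrak H\times\mathfrak H,\mathfrak H)$. (Under these assumptions $\mathrm T R_j(\zeta)\in\mathcal B(\mathcal H,\mathfrak H\times\mathfrak H)$.) *)

(* Defs.v *)
From HB Require Import structures.
From mathcomp Require Import all_boot all_order all_algebra.
From mathcomp Require Import sesquilinear.
From mathcomp Require Import all_classical all_reals.
From mathcomp Require Import topology normedtype.
From mathcomp.real_closed Require Export complex.

Set Implicit Arguments.
Unset Strict Implicit.
Unset Printing Implicit Defensive.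

Import Order.TTheory GRing.Theory Num.Theory Num.Def.

Local Open Scope classical_set_scope.
Local Open Scope ring_scope.

(* A complex Hilbert space is a [completeNormedModType R[i]] together with a
   form [d : {dot H for conjC}] (positive definite, linear in the first
   argument) that induces its norm. *)
Definition hilbert_form (R : realType) (H : normedModType R[i])
    (d : {dot H for conjC}) : Prop :=
  forall u : H, `|u| ^+ 2 = d u u.

Definition separable_space (T : topologicalType) : Prop :=
  exists2 S : set T, countable S & dense S.

(* The inner product of V x V.  The library norm of a product is the maximum of
   the norms of the components, which is equivalent to the norm of [prod_form],
   so the topology and the bounded operators are those of the Hilbert space
   V x V. *)
Definition prod_form (R : realType) (V : lmodType R[i]) (d : V -> V -> R[i])
    (f g : V * V) : R[i] :=
  d f.1 g.1 + d f.2 g.2.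

Definition is_subspace (R : realType) (V : lmodType R[i]) (F : set V) : Prop :=
  F 0 /\ forall (c : R[i]) (u v : V), F u -> F v -> F (c *: u + v).

(* The orthonormal bases of a closed subspace F are its maximal orthonormal
   subsets. *)
Definition orthonormal_basis (R : realType) (V : lmodType R[i])
    (d : V -> V -> R[i]) (F E : set V) : Prop :=
  [/\ E `<=` F,
      forall e, E e -> d e e = 1,
      forall e e', E e -> E e' -> e <> e' -> d e e' = 0
    & forall u, F u -> (forall e, E e -> d u e = 0) -> u = 0].

(* The Hilbert dimension is the cardinality of an orthonormal basis. *)
Definition same_hilbert_dim (R : realType) (V : lmodType R[i])
    (d : V -> V -> R[i]) (F1 F2 : set V) : Prop :=
  exists E1 E2 : set V,
    [/\ orthonormal_basis d F1 E1, orthonormal_basis d F2 E2 & (E1 #= E2)%card].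

(* Possibly unbounded operators: the values of [op] outside [dom] are
   irrelevant. *)
Record partial_op (V W : Type) := PartialOp { dom : set V; op :> V -> W }.

Definition total_op (V W : Type) (T : V -> W) : partial_op V W :=
  PartialOp setT T.

Section Operators.
Variable R : realType.
Implicit Types V W : normedModType R[i].

Definition linear_op V W (A : partial_op V W) : Prop :=
  is_subspace (dom A) /\
  forall (c : R[i]) (u v : V), dom A u -> dom A v ->
    A (c *: u + v) = c *: A u + A v.

Definition closed_op V W (A : partial_op V W) : Prop :=
  closed [set p : V * W | dom A p.1 /\ p.2 = A p.1].

Definition extends V W (B A : partial_op V W) : Prop :=
  dom A `<=` dom B /\ forall u, dom A u -> B u = A u.

Definition eq_op V W (A B : partial_op V W) : Prop :=
  dom A = dom B /\ forall u, dom A u -> A u = B u.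

(* The value of the adjoint is unique as soon as the operator is densely
   defined. *)
Definition adjoint V W (dV : V -> V -> R[i]) (dW : W -> W -> R[i])
    (A : partial_op V W) : partial_op W V :=
  let adj w := [set v | forall u, dom A u -> dW (A u) w = dV u v] in
  PartialOp [set w | adj w !=set0] (fun w => xget 0 (adj w)).

Definition symmetric_op V (d : V -> V -> R[i]) (A : partial_op V V) : Prop :=
  forall u v, dom A u -> dom A v -> d (A u) v = d u (A v).

Definition selfadjoint_op V (d : V -> V -> R[i]) (A : partial_op V V) : Prop :=
  [/\ linear_op A, dense (dom A) & eq_op A (adjoint d d A)].

Definition eigenset V (A : partial_op V V) (z : R[i]) : set V :=
  [set u | dom A u /\ A u = z *: u].

Definition equal_deficiency_indices V (d : V -> V -> R[i])
    (A : partial_op V V) : Prop :=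
  same_hilbert_dim d (eigenset (adjoint d d A) 'i)
                     (eigenset (adjoint d d A) (- 'i)).

Definition graph_form V (d : V -> V -> R[i]) (A : partial_op V V)
    (u v : V) : R[i] :=
  d u v + d (A u) (A v).

Definition graph_dense V (d : V -> V -> R[i]) (A : partial_op V V)
    (D : set V) : Prop :=
  D `<=` dom A /\
  forall u, dom A u -> forall e : R[i], 0 < e ->
    exists2 v, D v & sqrtC (graph_form d A (u - v) (u - v)) < e.

Definition bounded_op V W (T : V -> W) : Prop :=
  linear T /\ bounded_near T (nbhs (0 : V)).

Definition inverse_op V W (A : partial_op V W) : partial_op W V :=
  PartialOp (A @` dom A) (fun w => xget 0 [set u | dom A u /\ A u = w]).

Definition shift_op V (A : partial_op V V) (z : R[i]) : partial_op V V :=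
  PartialOp (dom A) (fun u => A u - z *: u).

Definition resolvent V (A : partial_op V V) (z : R[i]) : V -> V :=
  inverse_op (shift_op A z).

Definition resolvent_set V (A : partial_op V V) : set R[i] :=
  [set z | set_bij (dom A) setT (shift_op A z) /\ bounded_op (resolvent A z)].

Definition spectrum V (A : partial_op V V) : set R[i] := ~` resolvent_set A.

Definition adj V W (dV : V -> V -> R[i]) (dW : W -> W -> R[i]) (T : V -> W) :
    W -> V :=
  adjoint dV dW (total_op T).

Definition inv_op V W (T : V -> W) : W -> V := inverse_op (total_op T).

Definition orth_proj V (d : V -> V -> R[i]) (F : set V) (x : V) : V :=
  xget 0 [set y | F y /\ forall z, F z -> d (x - y) z = 0].

Definition row_op V (X Y : V -> V) (f : V * V) : V := X f.1 + Y f.2.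

Definition block_op V (X11 X12 X21 X22 : V -> V) (f : V * V) : V * V :=
  (row_op X11 X12 f, row_op X21 X22 f).

Definition J V : V * V -> V * V :=
  block_op (fun=> 0) idfun (\- idfun) (fun=> 0).

Definition omega V (d : V -> V -> R[i]) (f g : V * V) : R[i] :=
  prod_form d (J f) g.

Definition lagrangian V (d : V -> V -> R[i]) (F : set (V * V)) : Prop :=
  is_subspace F /\ F = [set f | forall g, F g -> omega d f g = 0].

Definition ker V W (T : V -> W) : set V := [set f | T f = 0].

(* W(X, Y) = (X X^* + Y Y^* )^-1 [- Y, X] and
   Z_{2,1} = W(X2, Y2)^* (X2 Y1^* - Y2 X1^* ) W(X1, Y1), where the inverse
   makes sense if X Y^* = Y X^* and the block operator [X, Y; - Y, X] is
   invertible. *)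
Definition Wop V (d : V -> V -> R[i]) (X Y : V -> V) : V * V -> V :=
  inv_op ((X \o adj d d X) \+ (Y \o adj d d Y)) \o row_op (\- Y) X.

Definition Zop V (d : V -> V -> R[i]) (X2 Y2 X1 Y1 : V -> V) :
    V * V -> V * V :=
  adj (prod_form d) d (Wop d X2 Y2)
  \o ((X2 \o adj d d Y1) \- (Y2 \o adj d d X1))
  \o Wop d X1 Y1.

Definition lagrangian_kernel V (d : V -> V -> R[i]) (F : set (V * V))
    (X Y : V -> V) : Prop :=
  [/\ lagrangian d F,
      bounded_op X /\ bounded_op Y,
      F = ker (row_op X Y),
      X \o adj d d Y = Y \o adj d d X
    & ~ spectrum (total_op (block_op X Y (\- Y) X)) 0].

End Operators.

Definition trace (U V : Type) (G0 G1 : U -> V) (u : U) : V * V :=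
  (G0 u, G1 u).

(* Main.v *)
(** Green's identity applied to [u = R_2(z^* ) g] and [v = R_1(z) h] reads
    [omega(T u, T v) = <g, (R_1(z) - R_2(z)) h>], because [A^* u = g + z^* u]
    and [A^* v = h + z v]; this is the resolvent formula in weak form.  The
    adjoints exist because [T R_j] is bounded: by Green's identity its pairings
    with the dense set of vectors [T v] are continuous functionals, and the
    uniform boundedness principle applies.

    For a plane [F = ker [X, Y]] put [M = [X, Y; -Y, X]] and
    [S = X X^* + Y Y^*].  Then [M M^* = diag(S, S)], so [S] is invertible and
    [M^* diag(S, S)^-1 M] is the identity.  Hence every [f] in [F] is
    [(-Y^* w, X^* w)] with [w = W(X, Y) f], which turns [omega] on [F_2 * F_1]
    into the form of [Z_{2,1}]; the same factorization provides the orthogonal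
    projection onto [F]. *)

Require Import Defs.
From HB Require Import structures.
From mathcomp Require Import all_boot all_order all_algebra.
From mathcomp Require Import sesquilinear.
From mathcomp Require Import all_classical all_reals.
From mathcomp Require Import topology normedtype.
From mathcomp Require Import ring lra.

Set Implicit Arguments.
Unset Strict Implicit.
Unset Printing Implicit Defensive.

Import Order.TTheory GRing.Theory Num.Theory Num.Def.

Local Open Scope classical_set_scope.
Local Open Scope ring_scope.

(** * Norms as real numbers, with density and completeness expressed through them *)

Section RealNorm.
Variable R : realType.
Local Notation "x %:C" := (real_complex R x) (format "x %:C").

(** Library norms over [R[i]] are complex numbers. Their real parts lie in an ordered real field,
    where infima, square roots and linear arithmetic are available. *)
Definition nrm (V : normedZmodType R[i]) (x : V) : R := complex.Re `|x|.

Lemma nrmE (V : normedZmodType R[i]) (x : V) : `|x| = (nrm x)%:C.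
Proof. by rewrite /nrm RRe_real// normr_real. Qed.

Section NormedZmodule.
Variable V : normedZmodType R[i].
Implicit Types x y : V.

Lemma nrm_ge0 x : 0 <= nrm x.
Proof. by rewrite -ler0c -nrmE. Qed.

Lemma nrm0 : nrm (0 : V) = 0.
Proof. by rewrite /nrm normr0. Qed.

Lemma nrm_eq0 x : nrm x = 0 -> x = 0.
Proof. by move=> x0; apply/normr0_eq0; rewrite nrmE x0. Qed.

Lemma nrm_gt0 x : x != 0 -> 0 < nrm x.
Proof.
move=> x0; rewrite lt_neqAle nrm_ge0 andbT eq_sym.
by apply: contra_neq x0; exact: nrm_eq0.
Qed.

Lemma nrmN x : nrm (- x) = nrm x.
Proof. by rewrite /nrm normrN. Qed.

Lemma nrmD x y : nrm (x + y) <= nrm x + nrm y.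
Proof. by rewrite -lecR rmorphD/= -!nrmE ler_normD. Qed.

Lemma nrmBC x y : nrm (x - y) = nrm (y - x).
Proof. by rewrite /nrm distrC. Qed.

Lemma nrm_leP x (e : R) : reflect (nrm x <= e) (`|x| <= e%:C).
Proof. by rewrite nrmE lecR; apply: idP. Qed.

Lemma nrm_ltP x (e : R) : reflect (nrm x < e) (`|x| < e%:C).
Proof. by rewrite nrmE ltcR; apply: idP. Qed.

End NormedZmodule.

Lemma posC_Re (e : R[i]) : 0 < e -> exists2 r : R, 0 < r & e = r%:C.
Proof.
move=> e0; have := RRe_real (gtr0_real e0) => eE; exists (complex.Re e) => //.
by rewrite -ltcR eE.
Qed.

Lemma nrmM (a b : R[i]) : nrm (a * b) = nrm a * nrm b.
Proof. by apply: complexI; rewrite rmorphM/= -!nrmE normrM. Qed.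

Lemma nrmC (a : R) : nrm a%:C = `|a|.
Proof.
by rewrite /nrm normc_def/= expr0n/= addr0 sqrtr_sqr.
Qed.

Lemma nrm_conj (a : R[i]) : nrm a^* = nrm a.
Proof. by rewrite /nrm norm_conjC. Qed.

Lemma nrmZ (V : normedModType R[i]) (a : R[i]) (x : V) :
  nrm (a *: x) = nrm a * nrm x.
Proof. by apply: complexI; rewrite rmorphM/= -!nrmE normrZ. Qed.

Lemma dense_nrm (V : normedModType R[i]) (S : set V) (x : V) (e : R) :
  dense S -> 0 < e -> exists2 y, S y & nrm (y - x) < e.
Proof.
move=> dS e0; have : (ball x e%:C)° !=set0.
  by exists x; apply: nbhsx_ballx; rewrite ltcR.
move=> /dS /(_ (@open_interior _ _)) [y [/interior_subset xy Sy]].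
exists y => //; apply/nrm_ltP; rewrite distrC.
by move: xy; rewrite -ball_normE.
Qed.

Lemma nrm_complete (V : completeNormedModType R[i]) (x : nat -> V) :
  (forall e : R, 0 < e -> exists N, forall m n, (N <= m)%N -> (N <= n)%N ->
     nrm (x m - x n) <= e) ->
  exists l, forall e : R, 0 < e -> exists N, forall n, (N <= n)%N ->
     nrm (x n - l) <= e.
Proof.
move=> xC.
have /cauchy_cvg : cauchy (x @ \oo).
  apply/cauchy_exP => e /posC_Re[r r0 ->].
  (* Balls are open: half the radius turns the weak estimate into a strict one. *)
  have [//|N NP] := xC (r / 2); first by rewrite divr_gt0.
  exists (x N); exists N => // n /= Nn.
  rewrite -ball_normE /=; apply/nrm_ltP/(le_lt_trans (NP _ _ _ _)) => //.
  by rewrite ltr_pdivrMr// ltr_pMr// ltr1n.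
move=> /cvg_ex[l xl]; exists l => e e0.
have /cvgrPdist_le /(_ e%:C) : x n @[n --> \oo] --> l by [].
rewrite ltcR => /(_ e0)[N _ NP]; exists N => n Nn.
by apply/nrm_leP; rewrite distrC; exact: NP.
Qed.

End RealNorm.

(** * Inner product calculus and the Cauchy-Schwarz inequality *)

Section InnerProduct.
Variables (R : realType) (H : normedModType R[i]) (d : {dot H for conjC}).
Local Notation "x %:C" := (real_complex R x) (format "x %:C").
Implicit Types (u v w : H) (a : R[i]).

Lemma dotC u v : d u v = (d v u)^*.
Proof. by rewrite (hermC d) expr0 mul1r. Qed.

Lemma dotDl u v w : d (u + v) w = d u w + d v w.
Proof. by rewrite linearDl. Qed.

Lemma dotBl u v w : d (u - v) w = d u w - d v w.
Proof. by rewrite linearBl. Qed.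

Lemma dotNl u v : d (- u) v = - d u v.
Proof. by rewrite linearNl. Qed.

Lemma dotZl a u v : d (a *: u) v = a * d u v.
Proof. by rewrite linearZl_LR. Qed.

Lemma dotDr u v w : d u (v + w) = d u v + d u w.
Proof. by rewrite linearDr. Qed.

Lemma dotBr u v w : d u (v - w) = d u v - d u w.
Proof. by rewrite linearBr. Qed.

Lemma dotNr u v : d u (- v) = - d u v.
Proof. by rewrite linearNr. Qed.

Lemma dotZr a u v : d u (a *: v) = a^* * d u v.
Proof. by rewrite linearZr_LR. Qed.

Lemma dot0l u : d 0 u = 0.
Proof. by rewrite linear0l. Qed.

Lemma dot0r u : d u 0 = 0.
Proof. by rewrite linear0r. Qed.

Lemma dot_injr u v : (forall w, d w u = d w v) -> u = v.
Proof.
move=> uv; apply/eqP; rewrite -subr_eq0 -(dnorm_eq0 d); apply/eqP.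
by rewrite dotBr uv subrr.
Qed.

Hypothesis hd : hilbert_form d.

Lemma dotE u : d u u = (nrm u ^+ 2)%:C.
Proof. by rewrite -hd nrmE rmorphXn. Qed.

(** The vector [w] is |v|^2 times the component of [u] orthogonal to [v]; its square norm is
    nonnegative, and dividing by |v|^2 gives the inequality. *)
Lemma dot_cs u v : nrm (d u v) <= nrm u * nrm v.
Proof.
have [->|v0] := eqVneq v 0; first by rewrite dot0r !nrm0 mulr0.
have nv : 0 < nrm v.
  exact: nrm_gt0.
set p := d u v; have pE : d v u = p^* by rewrite dotC.
pose s := nrm v ^+ 2; pose w := s%:C *: u - p *: v.
have sJ : (s%:C)^* = s%:C.
  by rewrite conj_Creal//; apply/complex_realP; exists s.
have : d w w = (s * (s * nrm u ^+ 2 - nrm p ^+ 2))%:C.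
  rewrite /w dotBl !dotBr !dotZl !dotZr !dotE -/p pE sJ.
  have -> : (s * (s * nrm u ^+ 2 - nrm p ^+ 2))%:C
      = s%:C * (s%:C * (nrm u ^+ 2)%:C - p * p^*).
    by rewrite -normCK nrmE -rmorphXn -rmorphM -rmorphB -rmorphM.
  by rewrite -/s; ring.
rewrite dotE => /complexI wE.
have s0 : 0 < s by rewrite exprn_gt0.
have : 0 <= s * (s * nrm u ^+ 2 - nrm p ^+ 2) by rewrite -wE sqr_ge0.
rewrite pmulr_rge0// subr_ge0 /s -exprMn mulrC.
by rewrite ler_sqr ?nnegrE ?mulr_ge0 ?nrm_ge0.
Qed.

(** If [x = u - v] were nonzero, some [y] in [S] would satisfy |y - x| < |x|. As [d y x = 0],
    Cauchy-Schwarz for [d (y - x) x] would give |x|^2 < |x|^2. *)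
Lemma dense_dot_injr (S : set H) u v :
  dense S -> (forall w, S w -> d w u = d w v) -> u = v.
Proof.
move=> dS uv; apply/eqP; rewrite -subr_eq0; apply/eqP/nrm_eq0.
set x := u - v; apply/eqP; rewrite eq_le nrm_ge0 andbT.
rewrite leNgt; apply/negP => x0.
have [y Sy yx] := dense_nrm x dS x0.
have : d (y - x) x = - (nrm x ^+ 2)%:C.
  by rewrite dotBl dotE [d y x]dotBr uv// subrr sub0r.
move=> /(congr1 (@nrm _ _)); rewrite nrmN nrmC ger0_norm ?sqr_ge0// => E.
have := dot_cs (y - x) x; rewrite E expr2 ler_pM2r// => /le_lt_trans/(_ yx).
by rewrite ltxx.
Qed.

End InnerProduct.

(** * Boundedness through an explicit real constant *)

Section BoundedOperators.
Variable R : realType.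
Local Notation "x %:C" := (real_complex R x) (format "x %:C").

Lemma bounded_opP (V W : normedModType R[i]) (T : V -> W) :
  bounded_op T <->
  linear T /\ exists2 C : R, 0 <= C & forall x, nrm (T x) <= C * nrm x.
Proof.
split=> -[lT bT]; split=> //.
  pose f : {linear V -> W} := HB.pack T (GRing.isLinear.Build _ _ _ _ T lT).
  have /linear_boundedP/pinfty_ex_gt0 [_ /posC_Re[C C0 ->] fC] :
    bounded_near f (nbhs 0) by [].
  exists C => [|x]; first exact: ltW.
  by rewrite -lecR rmorphM/= -!nrmE; exact: fC.
pose f : {linear V -> W} := HB.pack T (GRing.isLinear.Build _ _ _ _ T lT).
case: bT => C C0 TC; apply/(linear_boundedP f).
exists C%:C; split; first by apply/complex_realP; exists C.
move=> M CM x; rewrite (le_trans (y := C%:C * `|x|))//.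
  by rewrite !nrmE -rmorphM/= lecR TC.
by rewrite ler_wpM2r// ltW.
Qed.

End BoundedOperators.

(** * The Riesz representation theorem *)

Section Riesz.
Variables (R : realType) (H : completeNormedModType R[i]).
Variables (d : {dot H for conjC}) (hd : hilbert_form d).
Local Notation "x %:C" := (real_complex R x) (format "x %:C").
Local Notation Re := (@complex.Re R).

Lemma ReD (x y : R[i]) : Re (x + y) = Re x + Re y.
Proof. by case: x y => [? ?] [? ?]. Qed.

Lemma ReN (x : R[i]) : Re (- x) = - Re x.
Proof. by case: x. Qed.

Lemma ReJ (x : R[i]) : Re x^* = Re x.
Proof. by case: x. Qed.

Lemma Re_le_nrm (x : R[i]) : Re x <= nrm x.
Proof.
by rewrite -lecR -nrmE (le_trans _ (normc_ge_Re x))// lecR ler_norm.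
Qed.

Lemma nrm_sqrDZ (u v : H) (c : R[i]) :
  nrm (u + c *: v) ^+ 2
  = nrm u ^+ 2 + 2 * Re (c * d v u) + nrm c ^+ 2 * nrm v ^+ 2.
Proof.
have E : (nrm (u + c *: v) ^+ 2)%:C
    = (nrm u ^+ 2)%:C + (c * d v u + (c * d v u)^*)
      + (nrm c ^+ 2 * nrm v ^+ 2)%:C.
  have -> : (nrm c ^+ 2 * nrm v ^+ 2)%:C = c * c^* * (nrm v ^+ 2)%:C.
    by rewrite rmorphM/= rmorphXn/= -nrmE normCK.
  have -> : (c * d v u)^* = c^* * d u v by rewrite (dotC d u) -rmorphM.
  by rewrite -!(dotE hd) dotDl !dotDr !dotZl !dotZr; ring.
by move/(congr1 Re): E; rewrite !ReD ReJ/= => ->; ring.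
Qed.

(* The representing vector minimizes [|u|^2 - 2 Re (phi u)].  Comparing [u]
   with [u + c v] for the best [c] shows that at an almost minimizer [u] the
   functionals [d _ u] and [phi] almost agree, and applied to the difference
   of two almost minimizers this makes any minimizing sequence Cauchy. *)
Lemma riesz (phi : H -> R[i]) (C : R) :
  (forall a u v, phi (a *: u + v) = a * phi u + phi v) ->
  (forall u, nrm (phi u) <= C * nrm u) ->
  exists u, forall v, phi v = d v u.
Proof.
move=> lphi bphi.
have phi0 : phi 0 = 0.
  apply: nrm_eq0; apply/eqP.
  by rewrite eq_le nrm_ge0 (le_trans (bphi 0))// nrm0 mulr0.
have phiZ a v : phi (a *: v) = a * phi v.
  by rewrite -[a *: v]addr0 lphi phi0 addr0.
have phiD u v : phi (u + v) = phi u + phi v.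
  by rewrite -{1}[u]scale1r lphi mul1r.
(* If [r] represents [phi], then [Q u] is |u - r|^2 - |r|^2, so the minimizer sought is [r]. *)
pose Q u := nrm u ^+ 2 - 2 * Re (phi u).
have Qlb u : - C ^+ 2 <= Q u.
  rewrite /Q; have := Re_le_nrm (phi u); have := bphi u.
  have := sqr_ge0 (nrm u - C); lra.
have QD u v c : Q (u + c *: v)
    = Q u + 2 * Re (c * (d v u - phi v)) + nrm c ^+ 2 * nrm v ^+ 2.
  by rewrite /Q nrm_sqrDZ phiD phiZ mulrBr !ReD ReN; lra.
set m := inf (range Q).
have infQ : has_inf (range Q).
  by split; [exists (Q 0), 0 | exists (- C ^+ 2) => _ [u _ <-]].
have mQ u : m <= Q u by apply: ge_inf; [case: infQ | exists u].
have near_min u e v : Q u <= m + e ^+ 2 -> 0 <= e ->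
    nrm (d v u - phi v) <= e * nrm v.
  move=> Que e0; set a := d v u - phi v.
  have [v0|v0] := eqVneq (nrm v) 0.
    have -> : a = 0 by rewrite /a (nrm_eq0 v0) phi0 dot0l subrr.
    by rewrite nrm0 v0 mulr0.
  have {}v0 : 0 < nrm v by rewrite lt_neqAle eq_sym v0 nrm_ge0.
  pose s := (nrm v ^+ 2)^-1.
  (* This coefficient minimizes [Q (u + c *: v)] over [c]. The minimum lies |a|^2 / |v|^2 below
     [Q u], and an almost minimizer allows a drop of at most [e ^+ 2]. *)
  have := mQ (u + - (s%:C * a^*) *: v); rewrite QD -/a.
  have -> : - (s%:C * a^*) * a = (- (s * nrm a ^+ 2))%:C.
    rewrite rmorphN rmorphM/= rmorphXn/= -nrmE normCK; ring.
  rewrite nrmN nrmM nrmC nrm_conj.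
  rewrite ger0_norm; last by rewrite invr_ge0 sqr_ge0.
  have -> : (s * nrm a) ^+ 2 * nrm v ^+ 2 = s * nrm a ^+ 2.
    have sv : s * nrm v ^+ 2 = 1 by rewrite mulVf// gt_eqF ?exprn_gt0.
    by rewrite exprMn -[RHS]mul1r -sv; ring.
  move=> /= mle; have : s * nrm a ^+ 2 <= e ^+ 2 by lra.
  rewrite ler_pdivrMl ?exprn_gt0// -exprMn mulrC => H1.
  by rewrite -ler_sqr ?nnegrE ?mulr_ge0 ?nrm_ge0// mulrC.
have close u w e : Q u <= m + e ^+ 2 -> Q w <= m + e ^+ 2 -> 0 <= e ->
    nrm (u - w) <= e + e.
  move=> ue we e0.
  have [->|uw] := eqVneq (nrm (u - w)) 0; first exact: addr_ge0.
  have {}uw : 0 < nrm (u - w) by rewrite lt_neqAle eq_sym uw nrm_ge0.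
  have : nrm (d (u - w) (u - w)) <= (e + e) * nrm (u - w).
    rewrite mulrDl dotBr.
    have -> : d (u - w) u - d (u - w) w
      = (d (u - w) u - phi (u - w)) - (d (u - w) w - phi (u - w)) by ring.
    by rewrite (le_trans (nrmD _ _))// nrmN lerD// near_min.
  by rewrite (dotE hd) nrmC ger0_norm ?sqr_ge0// expr2 ler_pM2r.
(* The excess over [m] is a square because [near_min] and [close] take its square root as their
   error. *)
have /choice[u uP] n : exists u, Q u <= m + n.+1%:R^-1 ^+ 2.
  have n0 : 0 < (n.+1%:R^-1 : R) ^+ 2 by rewrite exprn_gt0// invr_gt0.
  by have [_ [u _ <-] /ltW] := inf_adherent n0 infQ; exists u.
have uN e : 0 < e -> exists N, forall n, (N <= n)%N -> Q (u n) <= m + e ^+ 2.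
  move=> e0; have eV : 0 < e^-1 by rewrite invr_gt0.
  exists (Num.bound e^-1) => n en; rewrite (le_trans (uP n))// lerD2l.
  rewrite ler_sqr ?nnegrE ?(ltW e0) ?invr_ge0// -[leRHS]invrK.
  rewrite lef_pV2 ?posrE// ltW// (lt_le_trans (archi_boundP (ltW eV)))//.
  by rewrite ler_nat leqW.
have [l ul] : exists l, forall e : R, 0 < e ->
    exists N, forall n, (N <= n)%N -> nrm (u n - l) <= e.
  apply: nrm_complete => e e0; have [N NP] := uN _ (divr_gt0 e0 (ltr0Sn _ 1)).
  by exists N => i j /NP Qi /NP Qj; rewrite (splitr e) close// ltW// divr_gt0.
exists l => v; apply/eqP; rewrite eq_sym -subr_eq0; apply/eqP/nrm_eq0/eqP.
rewrite eq_le nrm_ge0 andbT; apply/ler_addgt0Pr => e e0; rewrite add0r.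
(* The summand 1 keeps the divisor positive when [v = 0]. *)
have k0 : 0 < nrm v + 1 by rewrite ltr_wpDl ?nrm_ge0.
have f0 : 0 < e / 2 / (nrm v + 1) by rewrite !divr_gt0.
have fe : e / 2 / (nrm v + 1) * nrm v <= e / 2.
  by rewrite mulrAC ler_pdivrMr// ler_wpM2l ?divr_ge0 ?lerDl// ltW.
have [N NP] := uN _ f0; have [M MP] := ul _ f0.
have -> : d v l - phi v
    = (d v (u (maxn N M)) - phi v) - d v (u (maxn N M) - l).
  by rewrite dotBr; ring.
rewrite (le_trans (nrmD _ _))// nrmN [leRHS]splitr lerD// (le_trans _ fe)//.
  by rewrite near_min ?NP ?leq_maxl// ltW.
rewrite (le_trans (dot_cs hd _ _))// mulrC ler_wpM2r ?nrm_ge0//.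
by rewrite MP ?leq_maxr.
Qed.

End Riesz.

(** * The uniform boundedness principle for a family of seminorms *)

Section UniformBoundedness.
Variables (R : realType) (V : completeNormedModType R[i]) (I : Type).
Local Notation "x %:C" := (real_complex R x) (format "x %:C").
Variable p : I -> V -> R.
Hypothesis pD : forall i x y, p i (x + y) <= p i x + p i y.
Hypothesis pZ : forall i a x, p i (a *: x) = nrm a * p i x.
Hypothesis p_bounded : forall i, exists M, forall x, p i x <= M * nrm x.
Hypothesis p_pointwise : forall x, exists C, forall i, p i x <= C.

(* Nested balls: if the family is not uniformly bounded, then every ball
   contains a smaller ball on which some [p i] exceeds a prescribed bound. *)
Lemma uniform_boundedness :
  exists2 C : R, 0 <= C & forall i x, p i x <= C * nrm x.
Proof.
apply: contrapT => unb.
have pN i x : p i (- x) = p i x.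
  by rewrite -scaleN1r pZ nrmN nrmC ger0_norm// mul1r.
(* From a stage [n] and a ball (centre, radius), [g] produces a ball inside it, of radius at most
   1/(n+1), on which some [p i] is at least [n]. For a nonpositive radius its value is arbitrary. *)
have /choice[g gP] (nq : nat * (V * R)) : exists q : V * R, 0 < nq.2.2 ->
    [/\ 0 < q.2, q.2 <= nq.1.+1%:R^-1, nrm (q.1 - nq.2.1) + q.2 <= nq.2.2
      & exists i, forall z, nrm (z - q.1) <= q.2 -> nq.1%:R <= p i z].
  case: nq => n [x r] /=; have [r0|r0] := ltP 0 r; last by exists (0, 0).
  have [Cx pCx] := p_pointwise x.
  (* With this [K], the multiple of [u] of length [r / 2] has [p i] at least [n + 1 + |Cx|]. Adding
     [x] loses at most [Cx], and moving within the new ball at most 1. *)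
  pose K := (n.+1%:R + `|Cx|) * (2 / r).
  have K0 : 0 <= K by rewrite mulr_ge0 ?addr_ge0 ?divr_ge0 ?(ltW r0).
  have [i [u Ku]] : exists i u, K * nrm u < p i u.
    apply: contrapT => nK; apply: unb; exists K => // i u.
    by rewrite leNgt; apply/negP => Ku; apply: nK; exists i, u.
  have [M [M0 pM]] : exists M, 0 <= M /\ forall x, p i x <= M * nrm x.
    have [M pM] := p_bounded i; exists `|M|; split=> // y.
    by rewrite (le_trans (pM y))// ler_wpM2r ?nrm_ge0// ler_norm.
  have u0 : 0 < nrm u.
    rewrite lt_neqAle nrm_ge0 andbT; apply/eqP => u0.
    by have := lt_le_trans Ku (pM u); rewrite -u0 !mulr0 ltxx.
  pose c := r / 2 / nrm u; have c0 : 0 < c by rewrite !divr_gt0.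
  (* The three bounds keep the new ball inside the old one, make the radii tend to 0, and let [p i]
     vary by at most 1 on the new ball. *)
  pose s := Num.min (r / 2) (Num.min n.+1%:R^-1 (M + 1)^-1).
  have s0 : 0 < s by rewrite !lt_min !invr_gt0 ltr_wpDl// ltr0Sn divr_gt0.
  exists (x + c%:C *: u, s) => _; split => //=.
  - by rewrite !ge_min lexx orbT.
  - rewrite addrAC subrr add0r nrmZ nrmC gtr0_norm// /c divfK ?gt_eqF//.
    by rewrite [leRHS]splitr lerD2l ge_min lexx.
  - exists i => z zs.
    have M1 : 0 < M + 1 by rewrite ltr_wpDl.
    have Ms : M * s <= 1.
      have : s * (M + 1) <= 1.
        by rewrite -ler_pdivlMr// mul1r !ge_min lexx !orbT.
      by have := s0; lra.
    have Mz : p i (x + c%:C *: u - z) <= 1.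
      by rewrite (le_trans (pM _))// (le_trans _ Ms)// ler_wpM2l// nrmBC.
    have pu : n.+1%:R + `|Cx| <= p i (c%:C *: u).
      have cK : c * (K * nrm u) = n.+1%:R + `|Cx|.
        by rewrite /c /K; field; rewrite !gt_eqF.
      by rewrite pZ nrmC (gtr0_norm c0) -cK ler_wpM2l// ltW.
    have := pD i (x + c%:C *: u) (- x); rewrite addrAC subrr add0r pN.
    have := pD i (x + c%:C *: u - z) z; rewrite subrK.
    have := pCx i; have := ler_norm Cx; move: pu; rewrite -natr1; lra.
pose q := fix q n := if n is n'.+1 then g (n', q n') else (0, 1).
have q0 n : 0 < (q n).2.
  by elim: n => [|n IHn] /=; [exact: ltr01 | have [] := gP (n, q n) IHn].
have qr n : (q n.+1).2 <= n.+1%:R^-1 by have [] := gP (n, q n) (q0 n).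
have qd n k : nrm ((q (n + k)%N).1 - (q n).1) + (q (n + k)%N).2 <= (q n).2.
  elim: k => [|k IHk]; first by rewrite addn0 subrr nrm0 add0r.
  rewrite addnS; have [_ _ + _] := gP (n + k, q (n + k))%N (q0 _).
  rewrite -[g _]/(q (n + k).+1) /=.
  have := nrmD ((q (n + k).+1).1 - (q (n + k)%N).1) ((q (n + k)%N).1 - (q n).1).
  by rewrite addrA subrK; move: IHk; lra.
have qd' n m : (n <= m)%N -> nrm ((q m).1 - (q n).1) <= (q n).2.
  move=> /subnKC <-; have := qd n (m - n)%N; have := q0 (n + (m - n))%N; lra.
have [l ql] : exists l, forall e : R, 0 < e ->
    exists N, forall n, (N <= n)%N -> nrm ((q n).1 - l) <= e.
  apply: nrm_complete => e e0; have eV : 0 < 2 / e by rewrite divr_gt0.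
  pose N := Num.bound (2 / e).
  have qN : (q N.+1).2 <= e / 2.
    rewrite (le_trans (qr N))// -[leRHS]invrK invf_div lef_pV2 ?posrE//.
    by rewrite ltW// (lt_le_trans (archi_boundP (ltW eV)))// ler_nat leqW.
  exists N.+1 => m n Nm Nn.
  have := nrmD ((q m).1 - (q N.+1).1) ((q N.+1).1 - (q n).1).
  rewrite addrA subrK (nrmBC (q N.+1).1).
  by have := qd' _ _ Nm; have := qd' _ _ Nn; lra.
have lq n : nrm (l - (q n).1) <= (q n).2.
  apply/ler_addgt0Pr => e /ql[N /(_ (maxn N n) (leq_maxl _ _))].
  rewrite nrmBC => lN.
  have := nrmD (l - (q (maxn N n)).1) ((q (maxn N n)).1 - (q n).1).
  by rewrite addrA subrK; have := qd' _ _ (leq_maxr N n); lra.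
(* The limit lies in every ball, so at a stage beyond |C| some [p i l] exceeds its pointwise bound
   [C]. *)
have [C pC] := p_pointwise l.
have [_ _ _ [i /(_ _ (lq _.+1))]] :=
  gP (Num.bound `|C|, q (Num.bound `|C|)) (q0 _).
move=> /= Cp; have := archi_boundP (normr_ge0 C); rewrite ltNge => /negP; apply.
by rewrite (le_trans Cp)// (le_trans (pC i))// ler_norm.
Qed.

End UniformBoundedness.

(** * Adjoints of bounded and of densely defined operators *)

Section Adjoints.
Variable R : realType.

(** The value is chosen by [xget]; one representing vector determines it when the form separates
    points. *)
Lemma adj_eq (V W : normedModType R[i]) (dV : V -> V -> R[i])
    (dW : W -> W -> R[i]) (T : V -> W) (w : W) (v : V) :
  (forall x y, (forall u, dV u x = dV u y) -> x = y) ->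
  (forall u, dW (T u) w = dV u v) -> adj dV dW T w = v.
Proof.
move=> injV Tw; apply: xget_unique => [u _ //|x Tx].
by apply: injV => u; rewrite -Tx// Tw.
Qed.

Lemma adjP (V : completeNormedModType R[i]) (W : normedModType R[i])
    (dV : {dot V for conjC}) (dW : {dot W for conjC}) (T : V -> W) :
  hilbert_form dV -> hilbert_form dW -> bounded_op T ->
  forall u w, dW (T u) w = dV u (adj dV dW T w).
Proof.
move=> hV hW /bounded_opP[lT [C C0 TC]] u w.
have [|x|v Tv] := riesz hV (phi := fun u => dW (T u) w) (C := C * nrm w).
- by move=> a x y; rewrite lT dotDl dotZl.
- by rewrite (le_trans (dot_cs hW _ _))// mulrAC ler_wpM2r ?nrm_ge0.
by rewrite (@adj_eq _ _ dV dW T w v)//; exact: dot_injr.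
Qed.

Section DenseOperator.
Variables (H : normedModType R[i]) (d : {dot H for conjC}).
Hypothesis hd : hilbert_form d.

Lemma adjoint_eq (A : partial_op H H) (v w : H) :
  dense (dom A) -> (forall u, dom A u -> d (A u) v = d u w) ->
  dom (adjoint d d A) v /\ adjoint d d A v = w.
Proof.
move=> dA Avw; split; first by exists w.
apply: xget_unique => // x Ax; apply: (dense_dot_injr hd dA) => u Au.
by rewrite -Ax// Avw.
Qed.

Variable S : partial_op H H.
Hypothesis saS : selfadjoint_op d S.

Lemma selfadjoint_sym u v : dom S u -> dom S v -> d (S u) v = d u (S v).
Proof.
case: saS => _ _ [domE SE] Su Sv; rewrite (SE v Sv).
have : dom (adjoint d d S) v by rewrite -domE.
by move=> /(xgetPex 0); exact.
Qed.

(** The identity puts [v] in the domain of the adjoint, which is the domain of [S]. This is the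
    means of proving membership in the domain. *)
Lemma selfadjoint_mem v w : (forall u, dom S u -> d (S u) v = d u w) ->
  dom S v /\ S v = w.
Proof.
case: saS => _ dS [domE SE] /(adjoint_eq dS)[]; rewrite -domE => Sv <-.
by rewrite SE.
Qed.

(** A self-adjoint extension of [A] is a restriction of the adjoint of [A], so Green's identity can
    be read with [S]. *)
Lemma selfadjoint_extE (A : partial_op H H) u : dense (dom A) -> extends S A ->
  dom S u -> adjoint d d A u = S u.
Proof.
move=> dA [AS SA] Su; apply: proj2 (adjoint_eq dA _) => v Av.
by rewrite -SA// selfadjoint_sym//; exact: AS.
Qed.

End DenseOperator.
End Adjoints.

(** * Resolvents of self-adjoint operators and conjugate spectral points *)

Section Resolvent.
Variables (R : realType) (H : completeNormedModType R[i]).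
Variables (d : {dot H for conjC}) (hd : hilbert_form d).

Lemma notin_spectrum (A : partial_op H H) z :
  ~ spectrum A z -> resolvent_set A z.
Proof. exact: contrapT. Qed.

Lemma resolventP (A : partial_op H H) z h : resolvent_set A z ->
  dom A (resolvent A z h) /\ A (resolvent A z h) = h + z *: resolvent A z h.
Proof.
case=> -[_ _ /(_ h I)[u Au uh]] _; pose r := resolvent A z h.
have [Ar] : [set u | dom A u /\ shift_op A z u = h] r.
  exact: (@xgetI _ 0 [set u | dom A u /\ shift_op A z u = h] u).
by rewrite -/r => <-; rewrite /= subrK.
Qed.

Variable S : partial_op H H.
Hypothesis saS : selfadjoint_op d S.

(* The inverse of [S - z^*] is the adjoint of the inverse of [S - z]. *)
Lemma resolvent_set_conj z : resolvent_set S z -> resolvent_set S z^*.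
Proof.
move=> rz; have [[_ injz surjz] bz] := rz.
have symz u v : dom S u -> dom S v ->
    d (shift_op S z^* u) v = d u (shift_op S z v).
  move=> Su Sv; rewrite /= dotBl dotBr (selfadjoint_sym saS)//.
  by rewrite dotZl dotZr.
have [[[_ domD] SD] _ _] := saS.
have domB u v : dom S u -> dom S v -> dom S (u - v).
  by move=> Su Sv; rewrite addrC -scaleN1r; exact: domD.
(* Such a [u] is orthogonal to the range of [S - z], which is the whole space. *)
have inj u : dom S u -> shift_op S z^* u = 0 -> u = 0.
  move=> Su u0; apply: (@dot_injr _ _ d) => w; rewrite dot0r dotC.
  have [v Sv <-] := surjz w I.
  by rewrite -symz// u0 dot0l conjC0.
have shiftB u v : dom S u -> dom S v ->
    shift_op S z^* (u - v) = shift_op S z^* u - shift_op S z^* v.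
  move=> Su Sv /=; rewrite [u - v]addrC -scaleN1r SD//.
  rewrite !scaleN1r !(addrC (- _)) scalerBr !opprB addrACA [RHS]addrACA.
  by rewrite [- S v + _]addrC.
have [C C0 resC] : exists2 C : R, 0 <= C &
    forall x, nrm (resolvent S z x) <= C * nrm x.
  by move/bounded_opP: bz => [].
have surj h : exists u, dom S u /\ shift_op S z^* u = h.
  pose u := adj d d (resolvent S z) h; exists u.
  (* Since the resolvent inverts [S - z], one has <v, h> = <(S - z) v, u>, that is <S v, u> = <v, h
     + z^* u>. *)
  have [|Su uE] := selfadjoint_mem hd saS (v := u) (w := h + z^* *: u).
    move=> v Sv; have vE : resolvent S z (shift_op S z v) = v.
      have [Sr rE] := resolventP (shift_op S z v) rz.
      by apply: injz; rewrite ?inE//= rE/= addrK.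
    have := adjP hd hd bz (shift_op S z v) h.
    rewrite vE -/u /= dotBl dotZl => E.
    by rewrite dotDr dotZr conjCK E subrK.
  by split => //=; rewrite uE addrK.
have bij : set_bij (dom S) setT (shift_op S z^*).
  split=> // [u v | h _]; last by have [u [Su <-]] := surj h; exists u.
  rewrite !inE => Su Sv uv; apply/eqP; rewrite -subr_eq0; apply/eqP.
  by apply: inj; [exact: domB | rewrite shiftB// uv subrr].
have resE h :
    dom S (resolvent S z^* h) /\ shift_op S z^* (resolvent S z^* h) = h.
  have [u uP] := surj h.
  exact: (@xgetI _ 0 [set u | dom S u /\ shift_op S z^* u = h] u).
split=> //; apply/bounded_opP; split=> [a x y|].
  have [Sx xE] := resE x; have [Sy yE] := resE y.
  have [Sxy xyE] := resE (a *: x + y).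
  apply/eqP; rewrite -subr_eq0; apply/eqP; apply: inj; first exact/domB/domD.
  rewrite shiftB//; last exact: domD.
  have -> : shift_op S z^* (a *: resolvent S z^* x + resolvent S z^* y)
      = a *: shift_op S z^* (resolvent S z^* x)
        + shift_op S z^* (resolvent S z^* y).
    rewrite /= SD// scalerDr opprD addrACA scalerBr !scalerA.
    by rewrite [z^* * a]mulrC.
  by rewrite xyE xE yE subrr.
exists C => // h; have [Sh hE] := resE h.
have [->|u0] := eqVneq (resolvent S z^* h) 0.
  by rewrite nrm0 mulr_ge0 ?nrm_ge0.
set u := resolvent S z^* h in Sh hE u0 *.
have {}u0 : 0 < nrm u.
  exact: nrm_gt0.
have [Sr rE] := resolventP u rz.
(* Writing the second [u] as [S - z] applied to its resolvent and moving the shift across bounds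
   |u|^2 with the constant [C] of the resolvent at [z]. *)
have : nrm (d u u) <= nrm h * (C * nrm u).
  have -> : d u u = d h (resolvent S z u).
    by rewrite -hE symz//= rE addrK.
  by rewrite (le_trans (dot_cs hd _ _))// ler_wpM2l ?nrm_ge0.
rewrite (dotE hd) nrmC ger0_norm ?sqr_ge0// expr2.
by rewrite mulrA [nrm h * C]mulrC ler_pM2r.
Qed.

Lemma resolvent_adj z g h : resolvent_set S z ->
  d (resolvent S z^* g) h = d g (resolvent S z h).
Proof.
move=> rz; have [Sh hE] := resolventP h rz.
have [Sg gE] := resolventP g (resolvent_set_conj rz).
have := selfadjoint_sym saS Sg Sh; rewrite gE hE dotDl dotDr dotZl dotZr.
by move/addIr.
Qed.

End Resolvent.

(** * The product space, with its maximum norm and its inner product *)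

Section ProductNorm.
Variables (R : realType) (V : normedModType R[i]).
Implicit Types f : V * V.

Lemma nrm_prodE f : nrm f = Num.max (nrm f.1) (nrm f.2).
Proof.
apply: complexI; rewrite -nrmE prod_normE !nrmE /Order.max ltcR.
by case: ifP.
Qed.

Lemma nrm_fst f : nrm f.1 <= nrm f.
Proof. by rewrite nrm_prodE le_max lexx. Qed.

Lemma nrm_snd f : nrm f.2 <= nrm f.
Proof. by rewrite nrm_prodE le_max lexx orbT. Qed.

Lemma nrm_prod_le f : nrm f <= nrm f.1 + nrm f.2.
Proof. by rewrite nrm_prodE ge_max lerDl lerDr !nrm_ge0. Qed.

End ProductNorm.

Section ProductForm.
Variables (R : realType) (V : normedModType R[i]) (d : {dot V for conjC}).
Implicit Types f g h : V * V.

Lemma prod_formDl f g h :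
  prod_form d (f + g) h = prod_form d f h + prod_form d g h.
Proof. by rewrite /prod_form !dotDl addrACA. Qed.

Lemma prod_formBr f g h :
  prod_form d f (g - h) = prod_form d f g - prod_form d f h.
Proof. by rewrite /prod_form !dotBr opprD addrACA. Qed.

Lemma prod_formBl f g h :
  prod_form d (f - g) h = prod_form d f h - prod_form d g h.
Proof. by rewrite /prod_form !dotBl opprD addrACA. Qed.

Lemma prod_form_eq0 f : prod_form d f f = 0 -> f = 0.
Proof.
case: f => a b; rewrite /prod_form /= => /eqP.
by rewrite paddr_eq0 ?dnorm_ge0// !dnorm_eq0 => /andP[/eqP-> /eqP->].
Qed.

Lemma prod_form_injr f g :
  (forall h, prod_form d h f = prod_form d h g) -> f = g.
Proof.
move=> fg; apply/eqP; rewrite -subr_eq0; apply/eqP/prod_form_eq0.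
by rewrite prod_formBr fg subrr.
Qed.

(** For traces [f] and [g] this is minus the boundary term of Green's identity. *)
Lemma prod_form_J f g :
  prod_form d f (J g) = d f.1 g.2 - d f.2 g.1.
Proof. by rewrite /prod_form /J /block_op /row_op /= addr0 add0r dotNr. Qed.

End ProductForm.

(** * Boundedness of the trace composed with a resolvent *)

Section Trace.
Variables (R : realType) (H K : completeNormedModType R[i]).
Variables (dH : {dot H for conjC}) (dK : {dot K for conjC}).
Hypotheses (hH : hilbert_form dH) (hK : hilbert_form dK).
Variables (A : partial_op H H) (D : set H) (Gamma0 Gamma1 : H -> K).
Local Notation "x %:C" := (real_complex R x) (format "x %:C").
Local Notation T := (trace Gamma0 Gamma1).
Hypothesis dense_A : dense (dom A).
Hypothesis linear_T : linear_op (PartialOp D T).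
Hypothesis dense_T : dense (T @` D).
Hypothesis green : forall u v, D u -> D v ->
  dH (adjoint dH dH A u) v - dH u (adjoint dH dH A v)
  = dK (Gamma1 u) (Gamma0 v) - dK (Gamma0 u) (Gamma1 v).

(* The functionals [h |-> omega(T R(z) h, T v) / |T v|] are continuous by the
   Green identity and pointwise bounded, hence uniformly bounded; the vectors
   [T v] being dense, this bounds [T R(z)]. *)
Lemma bounded_trace_resolvent (S : partial_op H H) z :
  selfadjoint_op dH S -> extends S A -> dom S `<=` D -> resolvent_set S z ->
  bounded_op (T \o resolvent S z).
Proof.
move=> saS SA SD rz; have [lR [C C0 RC]] := (bounded_opP _).1 rz.2.
pose r h := resolvent S z h.
have Dr h : D (r h) by apply: SD; case: (resolventP h rz).
apply/bounded_opP; split=> [a x y|].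
  by rewrite /= lR; exact: linear_T.2 (Dr x) (Dr y).
pose phi v h := dK (Gamma1 (r h)) (Gamma0 v) - dK (Gamma0 (r h)) (Gamma1 v).
have phiE v h : D v ->
    phi v h = dH (h + z *: r h) v - dH (r h) (adjoint dH dH A v).
  move=> Dv; rewrite /phi -green//; have [Sr <-] := resolventP h rz.
  by rewrite (selfadjoint_extE hH saS dense_A SA Sr).
(* If [T v = 0], the inverse is 0 by convention; [phi v] vanishes as well, so [phiM] still holds for
   such [v]. *)
pose p (v : {v | D v}) h := (nrm (T (sval v)))^-1 * nrm (phi (sval v) h).
have nT_ge0 v : 0 <= (nrm (T v))^-1 by rewrite invr_ge0 nrm_ge0.
have [|||h|M M0 pM] := @uniform_boundedness R H {v | D v} p.
- move=> [v Dv] x y; rewrite /p /= -mulrDr ler_wpM2l//.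
  have -> : phi v (x + y) = phi v x + phi v y; last exact: nrmD.
  rewrite !phiE// /r -[x in LHS]scale1r lR !scale1r scalerDr addrACA !dotDl.
  by rewrite opprD addrACA.
- move=> [v Dv] a x; rewrite /p /= mulrCA -nrmM.
  suff -> : phi v (a *: x) = a * phi v x by [].
  have R0 : resolvent S z 0 = 0.
    apply: nrm_eq0; apply/eqP.
    by rewrite eq_le nrm_ge0 (le_trans (RC 0)) ?nrm0 ?mulr0.
  rewrite !phiE// /r -[a *: x in LHS]addr0 lR R0 !addr0 scalerA [z * a]mulrC.
  by rewrite -scalerA -scalerDr !dotZl mulrBr.
- move=> [v Dv]; set w := adjoint dH dH A v.
  exists ((nrm (T v))^-1 * ((1 + nrm z * C) * nrm v + C * nrm w)) => h.
  rewrite /p /= -mulrA ler_wpM2l// phiE// (le_trans (nrmD _ _))// nrmN.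
  have h1 := dot_cs hH (h + z *: r h) v; have h2 := dot_cs hH (r h) w.
  rewrite (le_trans (lerD h1 h2))// mulrDl lerD//.
    rewrite mulrAC ler_wpM2r ?nrm_ge0// (le_trans (nrmD _ _))// mulrDl mul1r.
    by rewrite lerD2l nrmZ -mulrA ler_wpM2l ?nrm_ge0.
  by rewrite mulrAC ler_wpM2r ?nrm_ge0.
- exists (nrm (Gamma1 (r h)) + nrm (Gamma0 (r h))) => -[v Dv]; rewrite /p /=.
  have : nrm (phi v h) <= nrm (T v) * (nrm (Gamma1 (r h)) + nrm (Gamma0 (r h))).
    rewrite (le_trans (nrmD _ _))// nrmN mulrDr lerD//.
      rewrite (le_trans (dot_cs hK _ _))// mulrC ler_wpM2r ?nrm_ge0//.
      exact: (nrm_fst (T v)).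
    rewrite (le_trans (dot_cs hK _ _))// mulrC ler_wpM2r ?nrm_ge0//.
    exact: (nrm_snd (T v)).
  have [->|Tv0] := eqVneq (nrm (T v)) 0 => phi_le.
    by rewrite invr0 mul0r addr_ge0 ?nrm_ge0.
  rewrite mulrC ler_pdivrMr; first by rewrite mulrC.
  by rewrite lt_neqAle eq_sym Tv0 nrm_ge0.
have phiM v h : D v -> nrm (phi v h) <= nrm (T v) * (M * nrm h).
  move=> Dv; have [Tv0|Tv0] := eqVneq (nrm (T v)) 0.
    have [G0 G1] : Gamma0 v = 0 /\ Gamma1 v = 0 by have [] := nrm_eq0 Tv0.
    by rewrite /phi G0 G1 !dot0r subrr nrm0 Tv0 mul0r.
  have := pM (exist _ v Dv) h; rewrite /p /= [_^-1 * _]mulrC.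
  rewrite ler_pdivrMr; first by rewrite mulrC.
  by rewrite lt_neqAle eq_sym Tv0 nrm_ge0.
(* With [F] the sum of the component norms, the estimate below reads F^2/2 <= (9/8) F M |h| + F^2/8,
   whence F <= 3 M |h|. *)
exists (3 * M) => [|h]; first by rewrite mulr_ge0.
rewrite (le_trans (nrm_prod_le (T (r h))))//=.
set f0 := Gamma0 (r h); set f1 := Gamma1 (r h); set F := nrm f0 + nrm f1.
have [F0|F0] := leP F 0; first by rewrite (le_trans F0)// !mulr_ge0// nrm_ge0.
have e0 : 0 < F / 8 by rewrite divr_gt0.
(* At [T v = (f1, - f0)] the functional would equal |f1|^2 + |f0|^2; a trace within [F / 8] of this
   point is close enough. *)
have [_ [v Dv <-] vf] := dense_nrm (f1, - f0) dense_T e0.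
have v0 : nrm (Gamma0 v - f1) <= F / 8.
  by rewrite (le_trans (nrm_fst (T v - (f1, - f0))))// ltW.
have v1 : nrm (Gamma1 v + f0) <= F / 8.
  rewrite -[f0]opprK (le_trans (nrm_snd (T v - (f1, - f0))))// ltW//.
have Tv : nrm (T v) <= F + F / 8.
  rewrite -[T v](subrK (f1, - f0)) (le_trans (nrmD _ _))// addrC.
  rewrite lerD//; last exact: ltW.
  by rewrite (le_trans (nrm_prod_le (f1, - f0)))//= nrmN addrC.
have phivE : (nrm f1 ^+ 2 + nrm f0 ^+ 2)%:C
    = phi v h - dK f1 (Gamma0 v - f1) + dK f0 (Gamma1 v + f0).
  by rewrite rmorphD/= -!(dotE hK) /phi -/f0 -/f1 dotBr dotDr; ring.
have : nrm f1 ^+ 2 + nrm f0 ^+ 2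
    <= (F + F / 8) * (M * nrm h) + nrm f1 * (F / 8) + nrm f0 * (F / 8).
  rewrite -[leLHS]ger0_norm ?addr_ge0 ?sqr_ge0// -nrmC phivE.
  rewrite (le_trans (nrmD _ _))// lerD//.
    rewrite (le_trans (nrmD _ _))// nrmN lerD//.
      by rewrite (le_trans (phiM _ _ Dv))// ler_wpM2r ?mulr_ge0 ?nrm_ge0.
    by rewrite (le_trans (dot_cs hK _ _))// ler_wpM2l ?nrm_ge0.
  by rewrite (le_trans (dot_cs hK _ _))// ler_wpM2l ?nrm_ge0.
move: (sqr_ge0 (nrm f1 - nrm f0)) F0; rewrite /F.
move: (nrm f0) (nrm f1) (nrm h) => a b x sq F0 le.
rewrite -(ler_pM2l F0); lra.
Qed.

End Trace.

(** * Orthogonal projections in the product space *)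

Section OrthogonalProjection.
Variables (R : realType) (K : normedModType R[i]) (d : {dot K for conjC}).
Implicit Types (F : set (K * K)) (x y f g : K * K).

Lemma prod_formC f g : prod_form d f g = (prod_form d g f)^*.
Proof. by rewrite /prod_form rmorphD/= !(dotC _ f.1, dotC _ f.2). Qed.

(** Two candidates differ by a vector of [F] that is orthogonal to [F], hence to itself. *)
Lemma orth_proj_eq F x y : (forall f g, F f -> F g -> F (f - g)) ->
  F y -> (forall f, F f -> prod_form d (x - y) f = 0) ->
  orth_proj (prod_form d) F x = y.
Proof.
move=> FB Fy xy; apply: xget_unique => // y' [Fy' xy'].
apply/eqP; rewrite -subr_eq0; apply/eqP/(prod_form_eq0 (d := d)).
have := FB _ _ Fy' Fy; set w := y' - y => Fw.
have wE : w = (x - y) - (x - y') by rewrite opprB [RHS]addrC addrA subrK.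
by rewrite {1}wE prod_formBl xy// xy'// subrr.
Qed.

End OrthogonalProjection.

(** * The kernel of [[X, Y]] through the block operator [M] *)

Section BlockOperator.
Variables (R : realType) (K : completeNormedModType R[i]).
Variables (d : {dot K for conjC}) (hd : hilbert_form d) (X Y : K -> K).
Hypotheses (bX : bounded_op X) (bY : bounded_op Y).
Hypothesis XY : X \o adj d d Y = Y \o adj d d X.
Local Notation M := (block_op X Y (\- Y) X).
Hypothesis M_inv : ~ spectrum (total_op M) 0.
Local Notation Xa := (adj d d X).
Local Notation Ya := (adj d d Y).
Local Notation S := ((X \o Xa) \+ (Y \o Ya)).

(** The adjoint of [M], with block matrix [[X^*, - Y^*; Y^*, X^*]]. *)
Let Ma (g : K * K) : K * K := (Xa g.1 - Ya g.2, Ya g.1 + Xa g.2).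

Let XD x y : X (x + y) = X x + X y.
Proof. by rewrite -{1}[x]scale1r bX.1 scale1r. Qed.

Let YD x y : Y (x + y) = Y x + Y y.
Proof. by rewrite -{1}[x]scale1r bY.1 scale1r. Qed.

Let X0 : X 0 = 0.
Proof. by apply: (addrI (X 0)); rewrite -XD !addr0. Qed.

Let Y0 : Y 0 = 0.
Proof. by apply: (addrI (Y 0)); rewrite -YD !addr0. Qed.

Let XN x : X (- x) = - X x.
Proof. by apply: (addIr (X x)); rewrite -XD !addNr X0. Qed.

Let YN x : Y (- x) = - Y x.
Proof. by apply: (addIr (Y x)); rewrite -YD !addNr Y0. Qed.

Let adjX u w : d (X u) w = d u (Xa w). Proof. exact: adjP. Qed.
Let adjY u w : d (Y u) w = d u (Ya w). Proof. exact: adjP. Qed.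

Let Xa0 : Xa 0 = 0.
Proof. by apply: (@dot_injr _ _ d) => u; rewrite -adjX !dot0r. Qed.

Let Ya0 : Ya 0 = 0.
Proof. by apply: (@dot_injr _ _ d) => u; rewrite -adjY !dot0r. Qed.

Let S0 : S 0 = 0.
Proof. by rewrite /= Xa0 Ya0 X0 Y0 addr0. Qed.

Let XYa b : X (Ya b) = Y (Xa b).
Proof. exact: (congr1 (@^~ b) XY). Qed.

Let M_adj f g : prod_form d (M f) g = prod_form d f (Ma g).
Proof.
rewrite /prod_form /Ma /block_op /row_op /= !dotDl dotNl !adjX !adjY.
by rewrite dotBr dotDr; ring.
Qed.

Let Ma_adj f g : prod_form d (Ma g) f = prod_form d g (M f).
Proof. by rewrite prod_formC -M_adj -prod_formC. Qed.

(** The off-diagonal blocks are [Y X^* - X Y^*] up to sign and vanish by [XY]. *)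
Let MMa g : M (Ma g) = (S g.1, S g.2).
Proof.
rewrite /Ma /block_op /row_op /= !XD !YD !XN !YN !XYa opprD opprK.
by congr (_, _); rewrite addrACA addNr ?addr0// add0r addrC.
Qed.

(* [M^* ] is onto because [M^-1] has an adjoint; since [M M^* = diag(S, S)],
   this makes [S] onto. *)
Let M_bij : exists N : K * K -> K * K,
  [/\ cancel N M, cancel M N & forall g, exists f, Ma f = g].
Proof.
have [[_ injM surjM] bN] := contrapT M_inv.
have shiftE f : shift_op (total_op M) 0 f = M f.
  by rewrite /shift_op /= scale0r subr0.
pose N := resolvent (total_op M) 0.
have NK g : M (N g) = g.
  have [f _ fg] := surjM g I; rewrite -shiftE.
  by case: (@xgetI _ 0 [set u | setT u /\ shift_op (total_op M) 0 u = g] f).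
have MK f : N (M f) = f by apply: injM; rewrite ?inE// !shiftE NK.
have [lN [C C0 NC]] := (bounded_opP _).1 bN.
have NL (c : R[i]) u v : N (c *: u + v) = c *: N u + N v by exact: lN.
exists N; split=> // g.
(* The maximum norm is not induced by [prod_form], so [riesz] is applied in [K] to each component;
   the two vectors together form [N^* g], and [M^* N^*] is the identity. *)
have riesz_part (i : K -> K * K) :
    (forall a u v, i (a *: u + v) = a *: i u + i v) ->
    (forall u, nrm (i u) <= nrm u) ->
    exists n, forall u, prod_form d (N (i u)) g = d u n.
  move=> li bi; apply: (riesz hd (C := C * (nrm g.1 + nrm g.2))).
    by move=> a u v; rewrite li NL prod_formDl /prod_form !dotZl mulrDr.
  move=> u; rewrite mulrAC mulrDr.
  have NC' : nrm (N (i u)) <= C * nrm u.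
    by rewrite (le_trans (NC _))// ler_wpM2l.
  rewrite (le_trans (nrmD _ _))// lerD// (le_trans (dot_cs hd _ _))//.
    by rewrite ler_wpM2r ?nrm_ge0// (le_trans (nrm_fst _)).
  by rewrite ler_wpM2r ?nrm_ge0// (le_trans (nrm_snd _)).
have [||n1 n1P] := riesz_part (fun u => (u, 0)).
- move=> a u v.
  by congr (_, _); rewrite -[RHS]/(a *: (0 : K) + 0) scaler0 addr0.
- by move=> u; rewrite (le_trans (nrm_prod_le (u, 0)))//= nrm0 addr0.
have [||n2 n2P] := riesz_part (fun u => (0, u)).
- move=> a u v.
  by congr (_, _); rewrite -[RHS]/(a *: (0 : K) + 0) scaler0 addr0.
- by move=> u; rewrite (le_trans (nrm_prod_le (0, u)))//= nrm0 add0r.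
exists (n1, n2); apply: (@prod_form_injr _ _ d) => h.
rewrite -M_adj -[in RHS](MK h).
case: (M h) => a b; have -> : (a, b) = 1 *: (a, 0) + (0, b) :> K * K.
  by rewrite scale1r; congr (_, _); rewrite /= ?addr0 ?add0r.
rewrite NL !scale1r !prod_formDl n1P n2P.
by rewrite /prod_form /= !dot0l addr0 add0r.
Qed.

Let S_surj k : exists u, S u = k.
Proof.
have [N [NK MK Ma_surj]] := M_bij.
have [g gE] := Ma_surj (N (k, 0)); exists g.1.
by have := MMa g; rewrite gE NK => -[].
Qed.

Lemma inv_opK k : S (inv_op S k) = k.
Proof.
by have [u uk] := S_surj k; case: (@xgetI _ 0 [set u | setT u /\ S u = k] u).
Qed.

(** With [w = W(X, Y) f], both [M f] and [M M^*] at [(0, w)] equal [(0, S w)], and [M] is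
    injective. *)
Lemma kernel_Wop f : ker (row_op X Y) f ->
  f = (- Ya (Wop d X Y f), Xa (Wop d X Y f)).
Proof.
move=> Xf; have [N [NK MK _]] := M_bij.
have /(can_inj MK) fE : M f = M (Ma (0, Wop d X Y f)).
  rewrite MMa; congr (_, _); last exact/esym/inv_opK.
  by rewrite [LHS]Xf; exact/esym/S0.
by rewrite [LHS]fE /Ma /= Xa0 Ya0 sub0r add0r.
Qed.

(** The adjoint is exhibited rather than obtained from a norm bound: with [S m = k], symmetry of [S]
    gives [(- Y^* m, X^* m)] as its value at [k]. *)
Lemma adj_Wop f k :
  d (Wop d X Y f) k = prod_form d f (adj (prod_form d) d (Wop d X Y) k).
Proof.
have S_sym u v : d (S u) v = d u (S v).
  have adjC Z Za : (forall x y, d (Z x) y = d x (Za y)) ->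
      d u (Z (Za v)) = d (Z (Za u)) v.
    by move=> adjZ; rewrite adjZ [LHS]dotC adjZ -dotC.
  by rewrite /= dotDl dotDr !adjC.
pose m := inv_op S k.
have W_adj g : d (Wop d X Y g) k = prod_form d g (- Ya m, Xa m).
  rewrite -(inv_opK k) -S_sym inv_opK /row_op /= dotDl dotNl adjX adjY.
  by rewrite /prod_form /= dotNr.
by rewrite W_adj (adj_eq (@prod_form_injr _ _ d) W_adj).
Qed.

(** Writing [f] as [M^*] applied to [(a, b)] splits it: the part from [(0, b)] lies in the kernel,
    and the part from [(a, 0)] pairs with [g] to [a] against [[X, Y] g], which is 0. *)
Lemma orth_proj_kernel f :
  let y := orth_proj (prod_form d) (ker (row_op X Y)) f in
  forall g, ker (row_op X Y) g -> prod_form d (f - y) g = 0.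
Proof.
move=> y; have [N [NK MK _]] := M_bij.
pose a := inv_op S (row_op X Y f); pose b := Wop d X Y f.
have fE : f = Ma (a, b).
  by apply: (can_inj MK); rewrite MMa; congr (_, _); exact/esym/inv_opK.
have ab g : ker (row_op X Y) g -> prod_form d (f - Ma (0, b)) g = 0.
  move=> g0; rewrite prod_formBl {1}fE !Ma_adj /prod_form /= !dot0l.
  by rewrite [row_op X Y g]g0 dot0r subrr.
have kerMa : ker (row_op X Y) (Ma (0, b)).
  exact: (etrans (congr1 fst (MMa (0, b))) S0).
have -> // : y = Ma (0, b).
apply: orth_proj_eq => // u v; rewrite /ker /row_op /= => u0 v0.
by rewrite !XD !YD !XN !YN addrACA u0 -opprD v0 subr0.
Qed.

Lemma orth_proj_kernel_id f : ker (row_op X Y) f ->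
  orth_proj (prod_form d) (ker (row_op X Y)) f = f.
Proof.
move=> Xf; apply: orth_proj_eq => // [u v|g _].
  rewrite /ker /row_op /= => u0 v0.
  by rewrite !XD !YD !XN !YN addrACA u0 -opprD v0 subr0.
by rewrite subrr /prod_form !dot0l addr0.
Qed.

End BlockOperator.

(** * The resolvent formula, in weak form and then in its operator forms *)

Lemma krein_form (R : realType) (H K : completeNormedModType R[i])
    (dH : {dot H for conjC}) (dK : {dot K for conjC}) (A A1 A2 : partial_op H H)
    (D : set H) (Gamma0 Gamma1 : H -> K) (z : R[i]) :
  hilbert_form dH -> dense (dom A) ->
  (forall u v, D u -> D v ->
     dH (adjoint dH dH A u) v - dH u (adjoint dH dH A v)
     = dK (Gamma1 u) (Gamma0 v) - dK (Gamma0 u) (Gamma1 v)) ->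
  selfadjoint_op dH A1 -> extends A1 A -> dom A1 `<=` D -> resolvent_set A1 z ->
  selfadjoint_op dH A2 -> extends A2 A -> dom A2 `<=` D -> resolvent_set A2 z ->
  forall g h,
    dK (Gamma0 (resolvent A2 z^* g)) (Gamma1 (resolvent A1 z h))
    - dK (Gamma1 (resolvent A2 z^* g)) (Gamma0 (resolvent A1 z h))
    = dH g (resolvent A2 z h - resolvent A1 z h).
Proof.
move=> hH dA green sa1 A1A D1 rz1 sa2 A2A D2 rz2 g h.
have [Sv vE] := resolventP h rz1.
have [Su uE] := resolventP g (resolvent_set_conj hH sa2 rz2).
have := green _ _ (D2 _ Su) (D1 _ Sv).
rewrite (selfadjoint_extE hH sa1 dA A1A Sv) (selfadjoint_extE hH sa2 dA A2A Su).
rewrite uE vE.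
(* The two terms [z^* <u, v>] cancel, and <u, h> becomes the pairing of [g] with the second
   resolvent at [z]. *)
rewrite dotDl dotDr dotZl dotZr dotBr (resolvent_adj hH sa2 g h rz2) => E.
by rewrite -[LHS]opprB -E; ring.
Qed.
Theorem theorem2p6 (R : realType)
    (H : completeNormedModType R[i]) (dH : {dot H for conjC})
    (K : completeNormedModType R[i]) (dK : {dot K for conjC})
    (hilbert_H : hilbert_form dH) (separable_H : separable_space H)
    (hilbert_K : hilbert_form dK) (separable_K : separable_space K)
    (A : partial_op H H)
    (linear_A : linear_op A) (dense_A : dense (dom A)) (closed_A : closed_op A)
    (symmetric_A : symmetric_op dH A)
    (deficiency_A : equal_deficiency_indices dH A)
    (D : set H) (Gamma0 Gamma1 : H -> K)
    (dense_D : graph_dense dH (adjoint dH dH A) D)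
    (domA_D : dom A `<=` D)
    (linear_T : linear_op (PartialOp D (trace Gamma0 Gamma1)))
    (dense_T : dense (trace Gamma0 Gamma1 @` D))
    (green : forall u v, D u -> D v ->
       dH (adjoint dH dH A u) v - dH u (adjoint dH dH A v)
       = dK (Gamma1 u) (Gamma0 v) - dK (Gamma0 u) (Gamma1 v))
    (A1 A2 : partial_op H H)
    (selfadjoint_A1 : selfadjoint_op dH A1) (A1_A : extends A1 A)
    (selfadjoint_A2 : selfadjoint_op dH A2) (A2_A : extends A2 A)
    (domA1_D : dom A1 `<=` D) (domA2_D : dom A2 `<=` D) :
  let T := trace Gamma0 Gamma1 in
  let R1 := resolvent A1 in
  let R2 := resolvent A2 in
  let F1 := closure (T @` dom A1) in
  let F2 := closure (T @` dom A2) in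
  let Q1 := orth_proj (prod_form dK) F1 in
  let Q2 := orth_proj (prod_form dK) F2 in
  (forall z : R[i], ~ (spectrum A1 `|` spectrum A2) z ->
     [/\ bounded_op (T \o R1 z^*),
         bounded_op (T \o R2 z^*),
         R2 z \- R1 z
         = (adj dH dK (Gamma0 \o R2 z^*) \o (Gamma1 \o R1 z))
           \- (adj dH dK (Gamma1 \o R2 z^*) \o (Gamma0 \o R1 z))
       & R2 z \- R1 z
         = adj dH (prod_form dK) (T \o R2 z^*) \o @J R K \o (T \o R1 z)])
  /\
  (forall X1 Y1 X2 Y2 : K -> K,
     lagrangian_kernel dK F1 X1 Y1 -> lagrangian_kernel dK F2 X2 Y2 ->
     forall z : R[i], ~ (spectrum A1 `|` spectrum A2) z ->
       R2 z \- R1 z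
       = adj dH (prod_form dK) (T \o R2 z^*)
         \o (Q2 \o @J R K \o Q1) \o (T \o R1 z)
       /\
       R2 z \- R1 z
       = adj dH (prod_form dK) (T \o R2 z^*)
         \o Zop dK X2 Y2 X1 Y1 \o (T \o R1 z)).
Proof.
move=> T R1 R2 F1 F2 Q1 Q2.
have rz z : ~ (spectrum A1 `|` spectrum A2) z ->
    resolvent_set A1 z /\ resolvent_set A2 z.
  by move=> zA; split; apply: notin_spectrum => zs; apply: zA; [left|right].
have bT S z := bounded_trace_resolvent hilbert_H hilbert_K dense_A linear_T
  dense_T green (S := S) (z := z).
have krein z (r1 : resolvent_set A1 z) (r2 : resolvent_set A2 z) :=
  krein_form hilbert_H dense_A green selfadjoint_A1 A1_A domA1_D r1
    selfadjoint_A2 A2_A domA2_D r2.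
have kreinJ z g h : resolvent_set A1 z -> resolvent_set A2 z ->
    prod_form dK (T (R2 z^* g)) (J (T (R1 z h)))
    = dH g (R2 z h - R1 z h).
  by move=> r1 r2; rewrite prod_form_J; exact: krein.
split=> [z /rz[rz1 rz2]|X1 Y1 X2 Y2 L1 L2 z /rz[rz1 rz2]].
  have bT2 := bT _ _ selfadjoint_A2 A2_A domA2_D
    (resolvent_set_conj hilbert_H selfadjoint_A2 rz2).
  split=> //.
  - exact: bT _ _ selfadjoint_A1 A1_A domA1_D
      (resolvent_set_conj hilbert_H selfadjoint_A1 rz1).
  - have [lT [C C0 TC]] := (bounded_opP _).1 bT2.
    (* Each component inherits linearity and the bound from the trace, so [adjP] applies to it. *)
    have bG0 : bounded_op (Gamma0 \o R2 z^*).
      apply/bounded_opP; split=> [a x y|]; first exact: (congr1 fst (lT a x y)).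
      exists C => // x.
      by rewrite (le_trans _ (TC x))// (nrm_fst (T (R2 z^* x))).
    have bG1 : bounded_op (Gamma1 \o R2 z^*).
      apply/bounded_opP; split=> [a x y|]; first exact: (congr1 snd (lT a x y)).
      exists C => // x.
      by rewrite (le_trans _ (TC x))// (nrm_snd (T (R2 z^* x))).
    apply/funext => h; apply: (@dot_injr _ _ dH) => g /=.
    by rewrite [RHS]dotBr -!(adjP hilbert_H hilbert_K)// /= -krein.
  (* The weak formula says exactly that the resolvent difference represents the functional defining
     this adjoint. *)
  - apply/funext => h; symmetry; apply: adj_eq; first exact: dot_injr.
    by move=> g; exact: kreinJ.
have [_ [bX1 bY1] F1E XY1 M1] := L1; have [_ [bX2 bY2] F2E XY2 M2] := L2.
have F1T h : F1 (T (R1 z h)).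
  by apply: subset_closure; exists (R1 z h) => //; case: (resolventP h rz1).
have F2T g : F2 (T (R2 z^* g)).
  apply: subset_closure; exists (R2 z^* g) => //.
  by case: (resolventP g (resolvent_set_conj hilbert_H selfadjoint_A2 rz2)).
split; apply/funext => h; symmetry; apply: adj_eq; try exact: dot_injr.
- move=> g; rewrite /= -[RHS]kreinJ//.
  have -> : Q1 (T (R1 z h)) = T (R1 z h).
    by rewrite /Q1 F1E; apply: orth_proj_kernel_id => //; rewrite -F1E.
  (* [w - Q2 w] is orthogonal to [F2], which contains the left trace, so [Q2] may be dropped. *)
  set w := J _; apply/eqP; rewrite eq_sym -subr_eq0 -prod_formBr prod_formC.
  rewrite /Q2 F2E orth_proj_kernel ?conjC0//; by rewrite -F2E.
- move=> g; rewrite /= -[RHS]kreinJ//.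
  have := F1T h; rewrite F1E => /(kernel_Wop hilbert_K bX1 bY1 XY1 M1).
  have := F2T g; rewrite F2E => /(kernel_Wop hilbert_K bX2 bY2 XY2 M2).
  (* Both traces take the form [(- Y^* w, X^* w)]; moving [X2] and [Y2] across the form then matches
     the two sides. *)
  rewrite -adj_Wop//; set f := T _; set f' := T _.
  set w := Wop _ _ _ f; set w' := Wop _ _ _ f' => -> ->.
  have adjC Z u v : bounded_op Z -> dK u (Z v) = dK (adj dK dK Z u) v.
    by move=> bZ; rewrite dotC (adjP hilbert_K hilbert_K bZ) -dotC.
  rewrite prod_form_J /= dotBr (adjC X2)// (adjC Y2)//.
  by rewrite dotNl dotNr opprK addrC.
Qed.
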